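(* Let $X\subseteq\omega$ be a BK-space and let $t\in[0,1)$. Suppose that (i) the sequence $x_t^{[0]}:=(t^n)_{n\in\mathbb{N}_0}$ belongs to $X$, and (ii) $C_t$ exists in $X$ and $C_t\in\mathcal{L}(X)$ is a compact operator. Then $C_t$ is power bounded and uniformly mean ergodic in $X$, and $$\|(C_t)_{[n]}-P\|_{X\to X}\to 0\quad\text{for } n\to\infty,$$ where $P$ is the projection onto $\mathrm{span}\{x_t^{[0]}\}$ along the subspace $(I-C_t)(X)$.
   Context: $\mathbb{N}_0=\{0,1,2,\dots\}$ and $\omega=\mathbb{C}^{\mathbb{N}_0}$ with the coordinatewise convergence topology. A BK-space is a linear subspace $X$ of $\omega$ equipped with a complete norm such that the inclusion $X\subseteq\omega$ is continuous (equivalently, all coordinate functionals are continuous on $X$). For $t\in[0,1]$ the generalized Cesàro operator on $\omega$ is $$C_tx=\Big(\frac{t^nx_0+t^{n-1}x_1+\dots+x_n}{n+1}\Big)_{n\in\mathbb{N}_0},\quad x=(x_n)_{n\in\mathbb{N}_0}\in\omega,$$ with the convention $t^0=1$ (also for $t=0$). ''$C_t$ exists in $X$'' means $C_t(X)\subseteq X$; the restriction to $X$ is again denoted $C_t$, and $\mathcal{L}(X)$ is the space of continuous linear operators on $X$. $I$ is the identity operator. For $T\in\mathcal{L}(X)$ the Cesàro means are $T_{[n]}:=\frac1n\sum_{m=1}^nT^m$, $n\ge 1$. $T$ is power bounded if $\sup_{n\ge 1}\|T^n\|_{X\to X}<\infty$; uniformly mean ergodic if $(T_{[n]})_{n\ge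 1}$ converges in operator norm. *)

(* Defs.v *)
From HB Require Import structures.
From mathcomp Require Import all_boot all_order all_algebra.
From mathcomp Require Import all_classical all_reals all_analysis.
From mathcomp Require Import complex.

Set Implicit Arguments.
Unset Strict Implicit.
Unset Printing Implicit Defensive.

Import Order.TTheory GRing.Theory Num.Theory.
Import numFieldNormedType.Exports.

Local Open Scope classical_set_scope.
Local Open Scope ring_scope.

(* The complex numbers are R[i], for an arbitrary R : realType. *)
Notation omega R := (nat -> R[i]^o).

(* A BK-space is a type X that is at once the subtype {x : omega R | x \in S}
   with the inherited vector space structure (so S is a linear subspace of
   omega R and [val] is the inclusion) and a complete normed space over R[i].
   The topology of X is the one of its norm; {ptws _ -> _} is the topology of
   coordinatewise convergence. *)
HB.mixin Record SubLmodule_isBKSpace (R : realType) (S : {pred omega R})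
    X & @GRing.SubLmodule R[i] (omega R) S X & CompleteNormedModule R[i] X := {
  val_continuous : continuous (val : X -> {ptws nat -> R[i]^o}) }.

#[short(type="bkSpaceType")]
HB.structure Definition BKSpace (R : realType) (S : {pred omega R}) :=
  { X of @GRing.SubLmodule R[i] (omega R) S X & CompleteNormedModule R[i] X
       & SubLmodule_isBKSpace R S X }.

Section SequenceOperators.
Context {R : realType}.

(* 0 ^+ 0 = 1, also for t = 0. *)
Definition cesaro_op (t : R) (x : omega R) : omega R :=
  fun n => (\sum_(k < n.+1) t%:C%C ^+ (n - k) * x k) / n.+1%:R.

Definition geom_seq (t : R) : omega R := fun n => t%:C%C ^+ n.

Definition exists_in (A : omega R -> omega R) (S : {pred omega R}) :=
  forall x, x \in S -> A x \in S.

Definition restr (S : {pred omega R}) (X : bkSpaceType S)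
    (A : omega R -> omega R) (AS : exists_in A S) : X -> X :=
  fun x => Sub (A (val x)) (AS _ (valP x)).

End SequenceOperators.

Arguments restr {R S} X {A} AS.

Section Operators.
Context {R : realType} {V : normedModType R[i]}.
Implicit Types T P : V -> V.

Definition continuous_operator T := linear T /\ continuous T.

Definition compact_operator T :=
  continuous_operator T /\ precompact (T @` [set x | `|x| <= 1]).

(* The norm of V takes its values in R[i]; they are real. The supremum is
   taken in \bar R, so that the norm of an unbounded map is +oo. *)
Definition opnorm T : \bar R :=
  ereal_sup [set (complex.Re `|T x|)%:E | x in [set x | `|x| <= 1]].

(* Only meaningful for n >= 1. *)
Definition cesaro_mean T (n : nat) : V -> V :=
  fun x => n%:R^-1 *: \sum_(1 <= m < n.+1) iter m T x.

Definition power_bounded T :=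
  (ereal_sup [set opnorm (iter n T) | n in [set n | (1 <= n)%N]] < +oo)%E.

Definition cvg_in_opnorm (F : nat -> V -> V) T :=
  opnorm (fun x => F n x - T x) @[n --> \oo] --> 0%E.

Definition uniformly_mean_ergodic T :=
  exists2 L, continuous_operator L & cvg_in_opnorm (cesaro_mean T) L.

Definition line (v : V) : set V := [set a *: v | a in [set: R[i]]].

(* P is the projection onto M along N. *)
Definition is_projection P (M N : set V) :=
  [/\ linear P, forall x, P (P x) = P x, range P = M & P @^-1` [set 0] = N].

End Operators.

(* Main.v *)
(** The projection is [P x = x_0 *: x_t], and everything follows from the bound
    [\sum_m `|Ct^m x| <= C `|x|] on the invariant subspace [D = {x | x_0 = 0}].
    Each coordinate of [Ct^n x], [x] in [D], is [O((3/4)^n `|x|)], since [Ct] is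
    lower triangular with diagonal [1 / (n + 1)]. If no power of [Ct] halved the
    norm on [D], then some orbits in [D] would contain arbitrarily late steps
    at which the norm is not much below its initial value and drops at most by a
    factor 2; normalizing there yields points of the image of the unit ball with
    norm at least [1/2] and coordinates tending to 0, which contradicts
    compactness. Halving gives the bound by iteration, and the Neumann series
    then shows that [I - Ct] maps [D] onto [D]. *)

From HB Require Import structures.
Require Import Defs.
From mathcomp Require Import all_boot all_order all_algebra.
From mathcomp Require Import all_classical all_reals all_analysis.
From mathcomp Require Import complex ring lra zify.
Import Order.TTheory GRing.Theory Num.Theory.
Import numFieldNormedType.Exports.
Local Open Scope classical_set_scope.
Local Open Scope ring_scope.

(** * Real-valued norms on normed spaces over [R[i]] *)

Section RealNorm.
Context {R : realType} {V : normedModType R[i]}.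
Implicit Types (x y : V) (a : R[i]^o) (c : R).

(** Norms are elements of [R[i]]; since they are real, passing to the real part loses nothing and
    gives access to the total order of [R]. *)
Definition rnorm {W : normedModType R[i]} (x : W) : R := complex.Re `|x|.

Lemma rnormE {W : normedModType R[i]} (x : W) : (rnorm x)%:C%C = `|x|.
Proof. by rewrite /rnorm RRe_real ?normr_real. Qed.

Lemma rnorm_ge0 x : 0 <= rnorm x.
Proof. by rewrite -lecR rnormE normr_ge0. Qed.

Lemma rnorm0 : rnorm (0 : V) = 0.
Proof. by rewrite /rnorm normr0. Qed.

Lemma rnorm_eq0 x : rnorm x = 0 -> x = 0.
Proof. by move=> x0; apply/eqP; rewrite -normr_eq0 -rnormE x0. Qed.

Lemma rnormD x y : rnorm (x + y) <= rnorm x + rnorm y.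
Proof. by rewrite -lecR rmorphD/= !rnormE ler_normD. Qed.

Lemma rnormN x : rnorm (- x) = rnorm x.
Proof. by rewrite /rnorm normrN. Qed.

Lemma rnormB x y : rnorm (x - y) <= rnorm x + rnorm y.
Proof. by rewrite -(rnormN y) rnormD. Qed.

Lemma rnormZ a x : rnorm (a *: x) = rnorm a * rnorm x.
Proof.
apply: (fmorph_inj (real_complex R)) => /=.
by rewrite rmorphM/= !rnormE normrZ.
Qed.

Lemma rnorm_sum (I : Type) (s : seq I) (Q : pred I) (F : I -> V) :
  rnorm (\sum_(i <- s | Q i) F i) <= \sum_(i <- s | Q i) rnorm (F i).
Proof.
elim/big_ind2: _ => [|x c y d xc yd|//]; first by rewrite rnorm0.
by apply: le_trans (rnormD _ _) _; apply: lerD.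
Qed.

Lemma rnorm_real c : 0 <= c -> rnorm (c%:C%C : R[i]^o) = c.
Proof. by move=> c0; rewrite /rnorm ger0_norm ?ler0c. Qed.

Lemma rnorm_continuous : continuous (rnorm : V -> R).
Proof.
move=> x; apply/cvgrPdist_lt => e e0; near=> y.
have: rnorm (x - y) < e.
  rewrite -ltcR rnormE; near: y.
  by apply: cvgr_dist_lt; [exact: cvg_id | rewrite ltcR].
apply: le_lt_trans; rewrite ler_norml.
have := rnormD (x - y) y; have := rnormD (y - x) x.
rewrite !subrK -(rnormN (y - x)) opprB.
by move=> ? ?; lra.
Unshelve. all: by end_near. Qed.

Lemma linear_continuous_bounded (W : normedModType R[i]) (f : V -> W) :
  linear f -> continuous f ->
  exists2 A, 1 <= A & forall x, rnorm (f x) <= A * rnorm x.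
Proof.
move=> flin fcont.
pose f' : {linear V -> W} := HB.pack f (GRing.isLinear.Build _ _ _ _ f flin).
have /linear_boundedP[M [Mreal Mf]] : bounded_near f' (nbhs 0).
  exact/linear_bounded_continuous.
have [c Mc] := complex_realP _ Mreal.
exists (1 + `|c|); first by rewrite lerDl.
move=> x; rewrite -lecR rmorphM/= !rnormE; apply: Mf.
by rewrite Mc ltcR (le_lt_trans (ler_norm c))// ltrDr.
Qed.

End RealNorm.

(** * Geometric decay and slow steps of real sequences *)

Lemma exists_geometric_lt {R : realType} (C r e : R) :
  0 <= r < 1 -> 0 < e -> exists n : nat, C * r ^+ n < e.
Proof.
move=> /andP[r0 r1] e0.
have : C * r ^+ n @[n --> \oo] --> C * 0.
  by apply: cvgMl_tmp; apply: cvg_expr; rewrite ger0_norm.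
rewrite mulr0 => /cvgr_lt/(_ _ e0)[n _ /(_ n (leqnn n))].
by exists n.
Qed.

(** Otherwise, going down from [N.+1] to [m0], each step more than doubles [u], so [u m0] exceeds
    [2 ^+ l * u 0]. But [u m0] is at most [A ^+ m0 * u 0], and [l] is chosen with
    [A ^+ m0 < 2 ^+ l]. Hence [N = m0 + l] serves all [u] at once. *)
Lemma exists_slow_step {R : realType} (A : R) (m0 : nat) : 1 <= A ->
  exists N, forall u : nat -> R,
    (forall n, 0 <= u n) -> (forall n, u n.+1 <= A * u n) ->
    u 0%N < 2 * u N.+1 ->
    exists2 m, (m0 <= m)%N & u m <= 2 * u m.+1 /\ u 0%N < 2 * u m.+1.
Proof.
move=> A1.
have [l Al] : exists l : nat, A ^+ m0 * 2^-1 ^+ l < 1.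
  by apply: exists_geometric_lt => //; apply/andP; split; lra.
exists (m0 + l)%N => u u0 uA; rewrite -addnS => un; apply: contrapT => H.
have uX m : u m <= A ^+ m * u 0%N.
  elim: m => [|m IH]; first by rewrite mul1r.
  apply: le_trans (uA m) _; rewrite exprS -mulrA ler_wpM2l//.
  exact: le_trans A1.
have grow k : (k <= l.+1)%N -> 2 ^+ k * u 0%N < 2 * u (m0 + (l.+1 - k))%N.
  elim: k => [|k IH] kl; first by rewrite subn0 mul1r.
  have := IH (ltnW kl); have -> : (l.+1 - k = (l.+1 - k.+1).+1)%N by lia.
  rewrite addnS; set m := (_ + _)%N => IHk.
  have um : u 0%N < 2 * u m.+1.
    by apply: le_lt_trans IHk; rewrite ler_peMl// exprn_ege1// ler1n.
  have : ~ (u m <= 2 * u m.+1).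
    by move=> ?; apply: H; exists m => //; apply: leq_addr.
  by move=> /negP; rewrite -ltNge exprS; lra.
have := grow l.+1 (leqnn _); rewrite subnn addn0.
have := uX m0; have := u0 0%N; move: Al.
have := exprn_gt0 l (ltr0Sn R 1).
rewrite exprVn ltr_pdivrMr; last by rewrite exprn_gt0.
rewrite mul1r exprS => l0 Al u00 um0 gl.
have : A ^+ m0 * u 0%N <= 2 ^+ l * u 0%N by rewrite ler_wpM2r// ltW.
lra.
Qed.

(** * Compactness, summable orbits and the Neumann series *)

Section CompactOperators.
Context {R : realType}.

(** The [p j] play the role of coordinates: they separate points, so their decay along orbits forces
    a cluster point of normalized late iterates to be 0. *)
Lemma compact_operator_halving (V : normedModType R[i]) (T : V -> V)
    (D : set V) (p : nat -> V -> R[i]^o) (M : nat -> R) (r : R) :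
  compact_operator T -> 0 <= r < 1 -> (forall j, 0 <= M j) ->
  (forall j, continuous (p j)) -> (forall j a x, p j (a *: x) = a *: p j x) ->
  (forall x, (forall j, p j x = 0) -> x = 0) ->
  (forall j x n, D x -> rnorm (p j (iter n T x)) <= M j * r ^+ n * rnorm x) ->
  exists N, forall x, D x -> rnorm (iter N.+1 T x) <= 2^-1 * rnorm x.
Proof.
move=> [Tco Tpre] /andP[r0 r1] M0 pcont pZ psep pdecay.
have [A A1 TA] := linear_continuous_bounded _ _ Tco.1 Tco.2.
have Tlin := Tco.1.
have TZ a x : T (a *: x) = a *: T x.
  pose T' : {linear V -> V} := HB.pack T (GRing.isLinear.Build _ _ _ _ T Tlin).
  exact: (linearZ_LR T').
apply: contrapT => /forallNP H.
have wex m0 : exists w, [/\ (T @` [set x | `|x| <= 1]) w, 2^-1 <= rnorm w &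
    forall j, rnorm (p j w) <= 2 * A * M j * r ^+ m0].
  have HN N : exists2 x, D x & 2^-1 * rnorm x < rnorm (iter N.+1 T x).
    have /existsNP[x /not_implyP[Dx /negP]] := H N.
    by rewrite -ltNge; exists x.
  have [N NP] := exists_slow_step A m0 A1.
  have [x Dx hx] := HN N.
  have [|||m mm0 []] := NP (fun n => rnorm (iter n T x)).
  - by move=> n; exact: rnorm_ge0.
  - by move=> n; exact: TA.
  - by rewrite /= in hx *; lra.
  move=> /= um ux; set q := rnorm (iter m T x) in um.
  (* If [q] were 0, the next iterate would vanish too, but its norm exceeds half of [rnorm x]. *)
  have q0 : 0 < q.
    have := rnorm_ge0 x; have := TA (iter m T x).
    rewrite -/q => h1 h2; rewrite ltNge; apply/negP => q0.
    have : A * q <= 0 by rewrite mulr_ge0_le0//; lra.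
    lra.
  have qV : rnorm ((q^-1)%:C%C : R[i]^o) = q^-1.
    by rewrite rnorm_real// invr_ge0 ltW.
  exists ((q^-1)%:C%C *: iter m.+1 T x); split.
  - exists ((q^-1)%:C%C *: iter m T x); last exact: TZ.
    by rewrite /= -rnormE -[1]/(1%:C%C) lecR rnormZ qV mulVf ?gt_eqF.
  - by rewrite rnormZ qV mulrC ler_pdivlMr//=; lra.
  - move=> j; rewrite pZ rnormZ qV mulrC ler_pdivrMr//.
    apply: le_trans (pdecay _ _ _ Dx) _.
    (* Late iterates are still comparable to [x]; this is where the factor [2 * A] comes from. *)
    have xq : rnorm x <= 2 * A * q by have := TA (iter m T x); rewrite -/q; lra.
    have -> : 2 * A * M j * r ^+ m0 * q = M j * r ^+ m0 * (2 * A * q) by ring.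
    rewrite ler_pM ?rnorm_ge0 ?mulr_ge0 ?exprn_ge0//.
    by rewrite ler_wpM2l//; apply: ler_wiXn2l; [|exact: ltW|exact: leqW].
have [w wP] := choice wex.
(* The closure of the image of the unit ball is compact, so the sequence [w] has a cluster point. *)
have [y [_ wy]] : closure (T @` [set x | `|x| <= 1]) `&` cluster (w @ \oo) !=set0.
  move: Tpre; rewrite precompactE; apply.
  by exists 0%N => // n _; apply: subset_closure; case: (wP n).
have clust (B : set V) m : closed B -> (forall n, (m <= n)%N -> B (w n)) -> B y.
  move=> Bcl Bw; rewrite (closure_id B).1//.
  by move: wy; rewrite clusterE; apply; exists m.
have : 2^-1 <= rnorm y.
  apply: (clust [set y | 2^-1 <= rnorm y] 0%N); last by move=> n _; case: (wP n).
  apply: (@preimage_closed _ _ rnorm [set z | 2^-1 <= z]).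
    by move=> z _; exact: rnorm_continuous.
  exact: closed_ge.
suff -> : y = 0 by rewrite rnorm0; lra.
(* The tail of [w] from [m] on satisfies a closed condition bounding [p j] by a multiple of
   [r ^+ m]; [y] inherits it for every [m]. *)
apply: psep => j; apply: rnorm_eq0; apply/eqP; rewrite eq_le rnorm_ge0 andbT.
rewrite leNgt; apply/negP => pj0.
have [|m] := @exists_geometric_lt _ (2 * A * M j) r _ _ pj0; first exact/andP.
apply/negP; rewrite -leNgt.
pose c := 2 * A * M j * r ^+ m.
apply: (clust [set y | rnorm (p j y) <= c] m).
  apply: (@preimage_closed _ _ (rnorm \o p j) [set z | z <= c]).
    move=> z _; apply: continuous_comp; [exact: pcont|exact: rnorm_continuous].
  exact: closed_le.
move=> n mn; have [_ _ /(_ j)] := wP n; move/le_trans; apply.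
rewrite ler_wpM2l//; last by rewrite ler_wiXn2l// ltW.
by rewrite !mulr_ge0// (le_trans _ A1).
Qed.

(** Cut the orbit into blocks of length [N.+1]. The first block contributes at most [C * rnorm x];
    the rest is the orbit of a vector of at most half the norm, and [C + 2 * C / 2 = 2 * C] closes
    the induction. *)
Lemma summable_orbits (V : normedModType R[i]) (T : V -> V) (D : set V) (N : nat) :
  continuous_operator T -> (forall x, D x -> D (T x)) ->
  (forall x, D x -> rnorm (iter N.+1 T x) <= 2^-1 * rnorm x) ->
  exists2 C, 0 <= C &
    forall x n, D x -> \sum_(m < n) rnorm (iter m T x) <= C * rnorm x.
Proof.
move=> Tco DT half; have [A A1 TA] := linear_continuous_bounded _ _ Tco.1 Tco.2.
have A0 : 0 <= A by exact: le_trans A1.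
have DiterT n x : D x -> D (iter n T x) by elim: n => //= n IH /IH /DT.
have iterT n x : rnorm (iter n T x) <= A ^+ n * rnorm x.
  elim: n => [|n IH]; first by rewrite mul1r.
  by apply: le_trans (TA _) _; rewrite exprS -mulrA ler_wpM2l.
pose C := \sum_(m < N.+1) A ^+ m.
have C0 : 0 <= C by apply: sumr_ge0 => m _; apply: exprn_ge0.
have short x n : (n <= N.+1)%N -> \sum_(m < n) rnorm (iter m T x) <= C * rnorm x.
  move=> nN; rewrite (big_ord_widen _ (fun m => rnorm (iter m T x)) nN).
  rewrite big_mkcond/= mulr_suml; apply: ler_sum => m _.
  by case: ifP => // _; rewrite mulr_ge0 ?rnorm_ge0 ?exprn_ge0.
exists (2 * C); first lra.
move=> x n; elim/ltn_ind: n x => n IH x Dx.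
have [nN|Nn] := leqP n N.+1.
  apply: le_trans (short _ _ nN) _.
  by rewrite ler_wpM2r ?rnorm_ge0//; lra.
have tail : \sum_(m < n - N.+1) rnorm (iter (N.+1 + m) T x) <=
    2 * C * rnorm (iter N.+1 T x).
  under eq_bigr do rewrite addnC iterD.
  by apply: IH; [lia|exact: DiterT].
rewrite -(subnKC (ltnW Nn)) big_split_ord/=.
apply: le_trans (lerD (short _ _ (leqnn _)) tail) _.
have := half _ Dx => h.
have : 2 * C * rnorm (iter N.+1 T x) <= 2 * C * (2^-1 * rnorm x).
  by rewrite ler_wpM2l//; lra.
lra.
Qed.

(** The solution is the sum of all [iter m T x], an absolutely convergent series in a complete
    space; the identity [series u n.+1 = x + T (series u n)] passes to the limit. *)
Lemma neumann_series (V : completeNormedModType R[i]) (T : V -> V) (x : V) (c : R) :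
  continuous_operator T -> (forall n, \sum_(m < n) rnorm (iter m T x) <= c) ->
  exists z, z - T z = x.
Proof.
move=> [Tlin Tcont] sumc.
pose T' : {linear V -> V} := HB.pack T (GRing.isLinear.Build _ _ _ _ T Tlin).
pose u m := iter m T x.
have cu : cvgn (series (fun m => rnorm (u m))).
  apply: nondecreasing_is_cvgn.
    by apply/nondecreasing_seqP => n; rewrite /series/= big_nat_recr//= lerDl rnorm_ge0.
  by exists c => _ [n _ <-]; rewrite /series/= big_mkord.
have : cvgn (series u).
  apply/cauchy_cvgP/cauchy_seriesP => e e0.
  have eE : (complex.Re e)%:C%C = e by rewrite RRe_real ?gtr0_real.
  have Re0 : 0 < complex.Re e by rewrite -ltcR eE.
  move/cauchy_cvgP/cauchy_seriesP : cu => /(_ _ Re0).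
  apply: filterS => n; rewrite -rnormE -eE ltcR; apply: le_lt_trans.
  by apply: le_trans (rnorm_sum _ _ _ _) _; exact: ler_norm.
move=> /cvg_ex[z uz]; exists z.
apply/eqP; rewrite subr_eq; apply/eqP.
have lim_z : series u n.+1 @[n --> \oo] --> z by have := uz; rewrite -cvg_shiftS.
apply: (cvg_unique _ lim_z) => //.
have -> : (fun n => series u n.+1) = (fun n => x + T (series u n)).
  apply/funext => n; rewrite /series/= big_nat_recl//= /u/=; congr +%R.
  by apply: esym; exact: (raddf_sum T').
apply: (cvgD (cvg_cst x)).
exact: (continuous_cvg _ (Tcont z)).
Qed.

End CompactOperators.

(** * Operator norms and convergence of Cesàro means *)

Section OperatorNorm.
Context {R : realType} {V : normedModType R[i]}.
Implicit Types (T P : V -> V) (c : R).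

Lemma opnorm_ge0 T : (0 <= opnorm T)%E.
Proof.
apply: le_trans (ereal_sup_ubound _); last first.
  by exists 0; [rewrite /= normr0 ler01|reflexivity].
by rewrite lee_fin; exact: rnorm_ge0.
Qed.

Lemma opnorm_le T c : 0 <= c -> (forall x, rnorm (T x) <= c * rnorm x) ->
  (opnorm T <= c%:E)%E.
Proof.
move=> c0 Tc; apply: ge_ereal_sup => _ [x /= x1 <-].
rewrite lee_fin -[leLHS]/(rnorm (T x)); apply: le_trans (Tc x) _.
by rewrite ler_piMr// -lecR rnormE.
Qed.

Lemma power_bounded_le T c : 0 <= c ->
  (forall x n, rnorm (iter n T x) <= c * rnorm x) -> power_bounded T.
Proof.
move=> c0 Tc; apply: le_lt_trans (ltry c).
by apply: ge_ereal_sup => _ [n _ <-]; apply: opnorm_le.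
Qed.

(** The deviation of the mean from [P] is the average of the deviations of the powers. Their sum
    stays bounded, so the rate is [c / n]. *)
Lemma cesaro_mean_cvg T P c : 0 <= c ->
  (forall x n, \sum_(m < n) rnorm (iter m.+1 T x - P x) <= c * rnorm x) ->
  cvg_in_opnorm (cesaro_mean T) P.
Proof.
move=> c0 sumc.
have lim0 : (c * n.+1%:R^-1)%:E @[n --> \oo] --> 0%E.
  apply: cvg_EFin; first by near=> n.
  rewrite -[X in _ --> X](mulr0 c); apply: cvgMl_tmp; exact: cvg_harmonic.
rewrite /cvg_in_opnorm -cvg_shiftS.
apply: (squeeze_cvge _ (cvg_cst _) lim0); near=> n.
rewrite opnorm_ge0/=; apply: opnorm_le; first by rewrite mulr_ge0.
move=> x.
have -> : cesaro_mean T n.+1 x - P x =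
    (n.+1%:R^-1)%:C%C *: \sum_(m < n.+1) (iter m.+1 T x - P x).
  rewrite /cesaro_mean big_add1/= big_mkord sumrB sumr_const card_ord scalerBr.
  rewrite fmorphV/= rmorph_nat -(scaler_nat _ (P x)) scalerA mulVf ?scale1r//.
rewrite rnormZ rnorm_real// mulrAC mulrC ler_wpM2r//.
exact: le_trans (rnorm_sum _ _ _ _) (sumc _ _).
Unshelve. all: by end_near. Qed.

End OperatorNorm.

(** * The generalized Cesàro operator on sequences *)

Section CesaroOperator.
Context {R : realType} (t : R) (t01 : 0 <= t <= 1).

Lemma rnorm_cesaro_op (x : omega R) n :
  rnorm (cesaro_op t x n) <= (\sum_(k < n.+1) rnorm (x k)) / n.+1%:R.
Proof.
have /andP[t0 t1] := t01.
rewrite /cesaro_op mulrC -[_^-1]/((n.+1%:R : R[i])^-1).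
have -> : (n.+1%:R : R[i])^-1 = (n.+1%:R^-1 : R)%:C%C by rewrite fmorphV/= rmorph_nat.
(* The product in [R[i]] is read as a scaling so that [rnormZ] applies. *)
rewrite [X in rnorm X]/(_ *: (_ : R[i]^o)) rnormZ rnorm_real// mulrC.
rewrite ler_wpM2r//; apply: le_trans (rnorm_sum _ _ _ _) _.
apply: ler_sum => k _; rewrite [X in rnorm X]/(_ *: (_ : R[i]^o)) rnormZ.
rewrite -rmorphXn/= rnorm_real ?exprn_ge0// ler_piMl ?rnorm_ge0//.
exact: exprn_ile1.
Qed.

(* Modulo the coordinates below [j], the operator multiplies the coordinate
   [j >= 1] by [1 / (j + 1) <= 1 / 2 < 3 / 4]. *)
Lemma iter_cesaro_op_decay (B : nat -> R) : (forall j, 0 <= B j) ->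
  exists M : nat -> R, (forall j, 0 <= M j) /\
    forall (x : omega R) c, 0 <= c -> x 0%N = 0 ->
      (forall k, rnorm (x k) <= B k * c) ->
      forall j n, rnorm (iter n (cesaro_op t) x j) <= M j * (3 / 4) ^+ n * c.
Proof.
move=> B0.
have r0 : 0 <= 3 / 4 :> R by lra.
(* The bound is made uniform over all [k <= j], since coordinate [j.+1] of the image involves every
   lower one. *)
suff /choice[M MP] : forall j, exists M, 0 <= M /\
    forall (x : omega R) c, 0 <= c -> x 0%N = 0 ->
      (forall k, rnorm (x k) <= B k * c) -> forall k n, (k <= j)%N ->
      rnorm (iter n (cesaro_op t) x k) <= M * (3 / 4) ^+ n * c.
  exists M; split=> [j|x c c0 x0 xB j n]; first exact: (MP j).1.
  exact: (MP j).2.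
elim=> [|j [M [M0 IH]]].
  exists 0; split=> // x c c0 x0 _ k n; rewrite leqn0 => /eqP ->.
  rewrite !mul0r; have -> : iter n (cesaro_op t) x 0%N = 0; last by rewrite rnorm0.
  elim: n => //= n IH.
  by rewrite /cesaro_op big_ord_recl big_ord0 IH mulr0 addr0 mul0r.
(* [B j.+1] covers [n = 0]; [4 * M] leaves room for the lower coordinates in the step on [n]. *)
exists (B j.+1 + 4 * M); split; first by rewrite addr_ge0 ?mulr_ge0.
move=> x c c0 x0 xB k n; rewrite leq_eqVlt => /predU1P[->|kj]; last first.
  apply: le_trans (IH _ _ c0 x0 xB k n kj) _.
  rewrite -!mulrA ler_wpM2r ?mulr_ge0 ?exprn_ge0//.
  by have := B0 j.+1; lra.
elim: n => [|n IHn].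
  by rewrite expr0 mulr1; apply: le_trans (xB _) _; rewrite ler_wpM2r// lerDl mulr_ge0.
rewrite iterS; apply: le_trans (rnorm_cesaro_op _ _) _.
rewrite ler_pdivrMr// big_ord_recr/=.
have low : \sum_(k < j.+1) rnorm (iter n (cesaro_op t) x k) <=
    j.+1%:R * (M * (3 / 4) ^+ n * c).
  rewrite mulr_natl -[X in _ *+ X]card_ord -sumr_const.
  by apply: ler_sum => i _; apply: IH => //; rewrite -ltnS.
apply: le_trans (lerD low IHn) _.
(* In terms of [w], [b], [j * w] and [j * b], all nonnegative, the remaining inequality is
   linear. *)
pose w := M * ((3 / 4) ^+ n * c); pose b := B j.+1 * ((3 / 4) ^+ n * c).
have w0 : 0 <= w by rewrite !mulr_ge0// exprn_ge0.
have b0 : 0 <= b by rewrite !mulr_ge0// exprn_ge0.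
have jw : 0 <= j%:R * w by rewrite mulr_ge0.
have jb : 0 <= j%:R * b by rewrite mulr_ge0.
have -> : (B j.+1 + 4 * M) * (3 / 4) ^+ n.+1 * c * j.+2%:R
  = 3 / 4 * (b + 4 * w) * (j%:R + 2) by rewrite /b /w exprS -addn2 natrD; ring.
have -> : j.+1%:R * (M * (3 / 4) ^+ n * c) + (B j.+1 + 4 * M) * (3 / 4) ^+ n * c
  = (j%:R + 1) * w + (b + 4 * w) by rewrite /b /w -addn1 natrD; ring.
lra.
Qed.

(** All [n.+1] summands of coordinate [n] equal [t ^ n]. *)
Lemma cesaro_op_geom : cesaro_op t (geom_seq t) = geom_seq t.
Proof.
apply/funext => n; rewrite /cesaro_op /geom_seq.
under eq_bigr => k _ do rewrite -exprD subnK -1?ltnS//.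
rewrite sumr_const card_ord -(mulr_natr (_ ^+ n)) mulfK//.
Qed.

End CesaroOperator.

Theorem theorem3p9 (R : realType) (S : {pred omega R}) (X : bkSpaceType S)
    (t : R) (t_ge0 : 0 <= t) (t_lt1 : t < 1)
    (geomS : geom_seq t \in S)
    (CtS : exists_in (cesaro_op t) S)
    (Ct_compact : compact_operator (restr X CtS)) :
  let Ct : X -> X := restr X CtS in
  let x_t : X := Sub (geom_seq t) geomS in
  [/\ power_bounded Ct,
      uniformly_mean_ergodic Ct
    & exists P : X -> X,
      [/\ continuous_operator P,
          is_projection P (line x_t) (range (fun x => x - Ct x))
        & cvg_in_opnorm (cesaro_mean Ct) P]].
Proof.
move=> Ct x_t.
have t01 : 0 <= t <= 1 by rewrite t_ge0 ltW.
have Ctco : continuous_operator Ct := Ct_compact.1.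
pose CtL : {linear X -> X} := HB.pack Ct (GRing.isLinear.Build _ _ _ _ Ct Ctco.1).
pose p j (x : X) : R[i]^o := val x j.
have plin j : linear (p j) by move=> a x y; rewrite /p linearP.
have pcont j : continuous (p j).
  move=> x; have vx := @val_continuous R S X x.
  exact: (cvg_comp _ _ vx (@proj_continuous nat (fun=> R[i]^o) j (val x))).
have pZ j a x : p j (a *: x) = a *: p j x by rewrite /p linearZ.
have pB j x y : p j (x - y) = p j x - p j y by rewrite /p raddfB.
have psep x : (forall j, p j x = 0) -> x = 0.
  by move=> px; apply: val_inj; rewrite raddf0; apply/funext => j; exact: px.
have iterC n x : val (iter n Ct x) = iter n (cesaro_op t) (val x).
  by elim: n => //= n <-; rewrite /Ct /restr SubK.
(* Coordinate 0 is preserved, which makes [D] invariant and puts the range of [I - Ct] inside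
   [D]. *)
have pC0 x : p 0%N (Ct x) = p 0%N x.
  rewrite /p [val _](iterC 1%N) /= /cesaro_op big_ord_recl big_ord0.
  by rewrite subnn expr0 mul1r addr0 divr1.
have px_t : p 0%N x_t = 1 by rewrite /p SubK /geom_seq expr0.
have Cx_t : Ct x_t = x_t.
  by apply: val_inj; rewrite [LHS](iterC 1%N) /= SubK cesaro_op_geom.
pose D := [set x | p 0%N x = 0].
have DC x : D x -> D (Ct x) by rewrite /D/= pC0.
(* Continuity of the coordinates bounds them by the norm of [X], as the decay estimate requires. *)
have /choice[B0 B0P] j : exists A, 1 <= A /\ forall x, rnorm (p j x) <= A * rnorm x.
  have [A A1 pA] := linear_continuous_bounded _ _ (plin j) (@pcont j).
  by exists A.
have [|M [M0 decay]] := iter_cesaro_op_decay t t01 B0.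
  by move=> j; rewrite (le_trans _ (B0P j).1).
have [||N half] := compact_operator_halving _ Ct D p M (3 / 4) Ct_compact _ M0 pcont pZ psep.
- by apply/andP; split; lra.
- move=> j x n Dx; rewrite /p iterC; apply: decay => //; first exact: rnorm_ge0.
  by move=> k; exact: (B0P k).2.
have [C C0 sumC] := summable_orbits _ _ _ _ Ctco DC half.
pose P x := p 0%N x *: x_t.
have Plin : linear P.
  by move=> a x y; rewrite /P plin scalerDl scalerA.
have Pcont : continuous P.
  by move=> x; apply: cvgZr_tmp; exact: pcont.
have PD x : D (x - P x) by rewrite /D/= /P pB pZ px_t -[_ *: 1]/(_ * 1) mulr1 subrr.
have CZ a x : Ct (a *: x) = a *: Ct x by exact: (linearZ_LR CtL).
have CB x y : Ct (x - y) = Ct x - Ct y by exact: (raddfB CtL).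
(* As [Ct] fixes [P x], the deviation of the powers from [P] is an orbit inside [D]. *)
have iterP n x : iter n Ct x - P x = iter n Ct (x - P x).
  by elim: n => //= n <-; rewrite CB /P CZ Cx_t.
have [A A1 IPA] : exists2 A, 1 <= A & forall x, rnorm (x - P x) <= A * rnorm x.
  have [A A1 PA] := linear_continuous_bounded _ _ Plin Pcont.
  exists (1 + A); first lra.
  move=> x; apply: le_trans (rnormB _ _) _.
  by rewrite mulrDl mul1r lerD2l.
have CA0 : 0 <= C * A by rewrite mulr_ge0//; lra.
have sumP x n : \sum_(m < n) rnorm (iter m Ct x - P x) <= C * A * rnorm x.
  under eq_bigr do rewrite iterP.
  by apply: le_trans (sumC _ _ (PD x)) _; rewrite -mulrA ler_wpM2l.
have Cmean : cvg_in_opnorm (cesaro_mean Ct) P.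
  apply: (cesaro_mean_cvg _ _ _ CA0) => x n.
  (* The means start at the first power, so the term of index 0 is dropped. *)
  apply: le_trans (sumP x n.+1).
  by rewrite [leRHS]big_ord_recl lerDr rnorm_ge0.
split.
- have [A' A'1 PA'] := linear_continuous_bounded _ _ Plin Pcont.
  apply: (power_bounded_le _ (C * A + A')); first lra.
  move=> x n; rewrite -(subrK (P x) (iter n Ct x)) mulrDl.
  apply: le_trans (rnormD _ _) _; apply: lerD => //.
  (* A single deviation is at most the whole sum. *)
  apply: le_trans (sumP x n.+1).
  by rewrite big_ord_recr/= lerDr; apply: sumr_ge0 => m _; exact: rnorm_ge0.
- by exists P.
exists P; split=> //; split=> //.
- by move=> x; rewrite /P pZ px_t -[_ *: 1]/(_ * 1) mulr1.
- apply/seteqP; split=> [_ [x _ <-]|_ [a _ <-]]; first by exists (p 0%N x).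
  by exists (a *: x_t) => //; rewrite /P pZ px_t -[_ *: 1]/(_ * 1) mulr1.
(* The kernel of [P] is contained in [D], where the Neumann series inverts [I - Ct]. *)
- apply/seteqP; split=> [x /= Px|_ [x _ <-]]; last first.
    by rewrite /= /P pB pC0 subrr scale0r.
  have Dx : D x by have := PD x; rewrite Px subr0.
  have [z zx] := neumann_series _ Ct x _ Ctco (fun n => sumC x n Dx).
  by exists z.
Qed.
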